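(* Let $\Omega\subseteq\mathbb{R}^n$ be a bounded weakly Lipschitz domain. Then there exists a LIP embedding $\Psi:\partial\Omega\times[-1,1]\to\mathbb{R}^n$ such that $\Psi(x,0)=x$ for all $x\in\partial\Omega$ and $$\Psi\left(\partial\Omega\times[-1,0)\right)\subseteq\Omega,\qquad \Psi\left(\partial\Omega\times(0,1]\right)\subseteq\overline\Omega^{c}.$$
   Context: Subsets of Euclidean spaces carry the Euclidean metric ($\partial\Omega\times[-1,1]$ is viewed as a subset of $\mathbb{R}^{n+1}$). A map $f:X\to Y$ is locally Lipschitz if every $x\in X$ has a relatively open neighborhood in $X$ on which $f$ is Lipschitz. A LIP embedding is an injective locally Lipschitz map $f:X\to Y$ such that $f^{-1}:f(X)\to X$ is also locally Lipschitz. $\overline\Omega^{c}$ is the complement of the closure of $\Omega$. An open set $\Omega\subseteq\mathbb{R}^n$ is a weakly Lipschitz domain if for every $x\in\partial\Omega$ there are a closed neighborhood $U_x$ of $x$ in $\mathbb{R}^n$ and a bi-Lipschitz map (invertible, Lipschitz with Lipschitz inverse) $\phi_x:U_x\to[-1,1]^n$ with $\phi_x(x)=0$, $\phi_x(\Omega\cap U_x)=[-1,1]^{n-1}\times[-1,0)$, $\phi_x(\partial\Omega\cap U_x)=[-1,1]^{n-1}\times\{0\}$, and $\phi_x(\overline\Omega^{c}\cap U_x)=[-1,1]^{n-1}\times(0,1]$. *)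

(* Defs.v *)
From HB Require Import structures.
From mathcomp Require Import all_boot all_order all_algebra.
From mathcomp Require Import all_classical all_reals all_analysis.

Set Implicit Arguments.
Unset Strict Implicit.
Unset Printing Implicit Defensive.

Import Order.TTheory GRing.Theory Num.Theory.
Import numFieldNormedType.Exports.

Local Open Scope classical_set_scope.
Local Open Scope ring_scope.

(* The library's norm on 'rV[R]_m is the sup norm.  Lipschitz conditions below
   use the Euclidean norm; open, closed, nbhs, closure, interior and bounded_set
   are the library's, the two norms having the same open sets and the same
   bounded sets. *)
Definition enorm (R : realType) (m : nat) (x : 'rV[R]_m) : R :=
  Num.sqrt (\sum_(i < m) x ord0 i ^+ 2).

Definition lipschitz_in (R : realType) (m k : nat)
    (X : set 'rV[R]_m) (f : 'rV[R]_m -> 'rV[R]_k) : Prop :=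
  exists L : R, forall x y, X x -> X y ->
    enorm (f x - f y) <= L * enorm (x - y).

Definition locally_lipschitz_in (R : realType) (m k : nat)
    (X : set 'rV[R]_m) (f : 'rV[R]_m -> 'rV[R]_k) : Prop :=
  forall x, X x ->
    exists O : set 'rV[R]_m, [/\ open O, O x & lipschitz_in (X `&` O) f].

(* Maps X -> Y are total functions of which only the values on X matter;
   g represents the inverse f @` X -> X. *)
Definition LIP_embedding (R : realType) (m k : nat)
    (X : set 'rV[R]_m) (f : 'rV[R]_m -> 'rV[R]_k) : Prop :=
  [/\ set_inj X f,
      locally_lipschitz_in X f &
      exists g : 'rV[R]_k -> 'rV[R]_m,
        (forall x, X x -> g (f x) = x) /\ locally_lipschitz_in (f @` X) g].

Definition biLipschitz_onto (R : realType) (m k : nat)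
    (X : set 'rV[R]_m) (Y : set 'rV[R]_k) (f : 'rV[R]_m -> 'rV[R]_k) : Prop :=
  [/\ set_bij X Y f,
      lipschitz_in X f &
      exists g : 'rV[R]_k -> 'rV[R]_m,
        (forall x, X x -> g (f x) = x) /\ lipschitz_in Y g].

Definition bdry (T : topologicalType) (A : set T) : set T :=
  closure A `\` interior A.

(* cube_slab J = [-1,1]^n x J; the last coordinate has index ord_max. *)
Definition cube_slab (R : realType) (n : nat) (J : set R) :
    set 'rV[R]_n.+1 :=
  [set y | (forall i, i != ord_max -> -1 <= y ord0 i <= 1) /\
           J (y ord0 ord_max)].

Definition weakly_Lipschitz_domain (R : realType) (n : nat)
    (Omega : set 'rV[R]_n.+1) : Prop :=
  open Omega /\
  forall x, bdry Omega x ->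
    exists (U : set 'rV[R]_n.+1) (phi : 'rV[R]_n.+1 -> 'rV[R]_n.+1),
      [/\ closed U, nbhs x U,
          biLipschitz_onto U (cube_slab `[-1, 1]) phi &
          [/\ phi x = 0,
              phi @` (Omega `&` U) = cube_slab `[-1, 0[,
              phi @` (bdry Omega `&` U) = cube_slab [set 0] &
              phi @` (~` closure Omega `&` U) = cube_slab `]0, 1]]].

(* The point (x, t) of R^n x R, as a vector of R^(n+1). *)
Definition pair_rv (R : realType) (n : nat) (x : 'rV[R]_n) (t : R) :
    'rV[R]_(n + 1) := row_mx x t%:M.

Definition cylinder (R : realType) (n : nat) (A : set 'rV[R]_n) (J : set R) :
    set 'rV[R]_(n + 1) :=
  [set z | exists x t, [/\ A x, J t & z = pair_rv x t]].

(* Main.v *)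
(* Attach to the closure of one side A of the compact boundary M an outer collar
   M x [0, +oo), giving an L-shaped set X in V x R.  In a chart, X becomes a cube
   extended upwards, and sliding vertically by a small bump function pushes the outer
   collar inwards; extended by the identity this is a bi-Lipschitz embedding of X into
   itself which maps (x, t) to (x, t - lam x) for x in M and t >= lam x.  Composing
   finitely many such pushes yields H with total displacement lam bounded below by
   some c > 0 on M, and (x, t) |-> H (x, lam x - c t) is a one-sided collar.  This
   replaces the flow of a transversal vector field, which need not exist here.  The
   collars of both sides agree on M and are glued there. *)
Require Import Defs.
From HB Require Import structures.
From mathcomp Require Import all_boot all_order all_algebra.
From mathcomp Require Import all_classical all_reals all_analysis.
From mathcomp Require Import lra.

Set Implicit Arguments.
Unset Strict Implicit.
Unset Printing Implicit Defensive.

Import Order.TTheory GRing.Theory Num.Theory.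
Import numFieldNormedType.Exports.

Local Open Scope classical_set_scope.
Local Open Scope ring_scope.

(** * Sliding the real line: a bi-Lipschitz cutoff of a translation *)

Section Slide.
Variables (R : realType) (e : R).
Hypothesis e_gt0 : 0 < e.

(** Piecewise linear cutoff, 0 up to [- 2e] and 1 from 0 on. Its slope [1 / (2e)] in between keeps
    the slope of [slide l] at least 1/2 when [0 <= l <= e]. *)
Definition ramp (s : R) : R := Num.max 0 (Num.min 1 (1 + s / (2 * e))).

Definition slide (l s : R) : R := s - l * ramp s.

Lemma ramp_ge0 s : 0 <= ramp s.
Proof. by rewrite /ramp le_max lexx. Qed.

Lemma ramp_le1 s : ramp s <= 1.
Proof. by rewrite /ramp ge_max ler01 ge_min lexx. Qed.

Lemma ramp1 s : 0 <= s -> ramp s = 1.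
Proof.
move=> s0; have ? : 0 <= s / (2 * e) by rewrite divr_ge0// mulr_ge0// ltW.
by rewrite /ramp min_l ?max_r ?ler01//; lra.
Qed.

Lemma ramp0 s : s <= - (2 * e) -> ramp s = 0.
Proof.
move=> se; have ? : s / (2 * e) <= -1 by rewrite ler_pdivrMr ?mulr_gt0//; lra.
by rewrite /ramp min_r ?max_l//; lra.
Qed.

Lemma ramp_lip s s' : `|ramp s - ramp s'| <= `|s - s'| / (2 * e).
Proof.
have e2 : 0 < 2 * e by rewrite mulr_gt0.
have -> : `|s - s'| / (2 * e) = `|s / (2 * e) - s' / (2 * e)|.
  by rewrite -mulrBl normrM [`|(2 * e)^-1|]gtr0_norm ?invr_gt0.
rewrite /ramp; move: (s / (2 * e)) (s' / (2 * e)) => u v.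
rewrite ler_norml; have := ler_norm (u - v); have := ler_norm (v - u).
rewrite (distrC v); move: `|u - v| => w.
by case: (leP 1 (1 + u)); case: (leP 1 (1 + v)); case: (leP 0 (1 + u));
  case: (leP 0 (1 + v)); case: (leP (0 : R) 1) => *; lra.
Qed.

Lemma slide_ge0 l s : 0 <= s -> slide l s = s - l.
Proof. by move=> s0; rewrite /slide ramp1// mulr1. Qed.

Lemma slide_low l s : s <= - (2 * e) -> slide l s = s.
Proof. by move=> s0; rewrite /slide ramp0// mulr0 subr0. Qed.

Lemma slide0 s : slide 0 s = s.
Proof. by rewrite /slide mul0r subr0. Qed.

Lemma slide_le l s : 0 <= l -> slide l s <= s.
Proof. by move=> l0; rewrite gerBl mulr_ge0// ramp_ge0. Qed.

Lemma slide_dist l s : 0 <= l <= e -> `|slide l s - s| <= e.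
Proof.
move=> /andP[l0 le]; rewrite /slide addrC addKr normrN normrM !ger0_norm ?ramp_ge0//.
by rewrite (le_trans _ le)// ler_piMr// ramp_le1.
Qed.

(** On [[-2e, 0]] one has [s + 2e = 2e * ramp s], which dominates [l * ramp s]; for [s >= 0] the
    drop is only [l <= e]. *)
Lemma slide_lower l s : 0 <= l <= e -> - (2 * e) <= s -> - (2 * e) <= slide l s.
Proof.
move=> /andP[l0 le] sl; have [s0|s0] := leP 0 s; first by rewrite slide_ge0//; lra.
rewrite /slide; suff : l * ramp s <= s + 2 * e by lra.
have u0 : 0 <= 1 + s / (2 * e).
  have : -1 <= s / (2 * e) by rewrite ler_pdivlMr ?mulr_gt0//; lra.
  by lra.
have -> : ramp s = 1 + s / (2 * e).
  rewrite /ramp min_r ?max_r// gerDl pmulr_lle0 ?invr_gt0 ?ltW//; lra.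
have -> : s + 2 * e = 2 * e * (1 + s / (2 * e)).
  by rewrite mulrDr mulr1 mulrCA divff ?mulr1 ?(addrC s)//; lra.
by rewrite ler_wpM2r//; lra.
Qed.

(** Up to sign the error is [(l - l') * ramp s + l' * (ramp s - ramp s')], whose second term is at
    most [e * |s - s'| / (2e)]. The factor 1/2 < 1 later yields the Lipschitz inverse. *)
Lemma slide_perturb l l' s s' : 0 <= l <= e -> 0 <= l' <= e ->
  `|(slide l s - slide l' s') - (s - s')| <= `|l - l'| + `|s - s'| / 2.
Proof.
move=> /andP[l0 le] /andP[l'0 l'e].
have -> : (slide l s - slide l' s') - (s - s') =
    - ((l - l') * ramp s + l' * (ramp s - ramp s')).
  by rewrite /slide; lra.
rewrite normrN (le_trans (ler_normD _ _))// !normrM lerD//.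
  by rewrite ler_piMr// ger0_norm ?ramp_ge0// ramp_le1.
apply: (@le_trans _ _ (e * (`|s - s'| / (2 * e)))); last first.
  by rewrite invfM mulrCA (mulrCA e) divff ?gt_eqF// mulr1.
by rewrite ler_pM// ?ramp_lip// ger0_norm.
Qed.

End Slide.

(** * Pushes of the L-shaped set and their composition *)

Section OneSide.
Variables (R : realType) (V : normedModType R) (A M : set V).
Hypothesis AM : A `&` M = set0.
Implicit Types (z : V * R) (p q : V).

(* The one-sided neighbourhood A of M with an outer collar M x [0, +oo)
   attached along M, realised as an L-shaped subset of V x R. *)
Definition lshape : set (V * R) :=
  [set z | (A z.1 /\ z.2 = 0) \/ (M z.1 /\ 0 <= z.2)].

(** The sum metric on [V * R]: component estimates add up and stay within linear arithmetic. *)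
Definition dist1 z z' : R := `|z.1 - z'.1| + `|z.2 - z'.2|.

Lemma dist1_ge0 z z' : 0 <= dist1 z z'.
Proof. by rewrite addr_ge0. Qed.

Lemma dist1xx z : dist1 z z = 0.
Proof. by rewrite /dist1 !subrr !normr0 addr0. Qed.

Lemma dist1C z z' : dist1 z z' = dist1 z' z.
Proof. by rewrite /dist1 distrC (distrC z.2). Qed.

Lemma dist1_triangle z' z z'' : dist1 z z'' <= dist1 z z' + dist1 z' z''.
Proof.
rewrite /dist1; have := ler_distD z'.1 z.1 z''.1; have := ler_distD z'.2 z.2 z''.2.
lra.
Qed.

(** [lam] is the drop of the collar: points at height at least [lam p] descend by it, lower ones
    pass through M into A. [push_inside] keeps points of A in A, as composition requires. *)
Record push (lam : V -> R) (H : V * R -> V * R) : Prop := Push {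
  push_ge0 : forall p, 0 <= lam p;
  push_lip : exists2 K, 0 <= K & forall p q, `|lam p - lam q| <= K * `|p - q|;
  push_stable : forall z, lshape z -> lshape (H z);
  push_bilip : exists2 K, 0 <= K & forall z z', lshape z -> lshape z' ->
    dist1 (H z) (H z') <= K * dist1 z z' /\ dist1 z z' <= K * dist1 (H z) (H z');
  push_above : forall p t, M p -> lam p <= t -> H (p, t) = (p, t - lam p);
  push_below : forall p t, M p -> 0 <= t -> t < lam p -> A (H (p, t)).1;
  push_inside : forall p, A p -> A (H (p, 0)).1 }.

Lemma lshape_A z : lshape z -> A z.1 -> z = (z.1, 0).
Proof.
case: z => p t [[_ /= ->]//|[/= Mp _] Ap].
by have : (A `&` M) p by []; rewrite AM.
Qed.

Lemma push_id : push (fun=> 0) id.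
Proof.
split=> //.
- by exists 0 => // p q; rewrite subrr normr0 mul0r.
- by exists 1 => // z z' _ _; rewrite mul1r.
- by move=> p t _ _; rewrite subr0.
- by move=> p t _ t0; rewrite ltNge t0.
Qed.

(** The drops add up along the collar. A point at height below [lam p + mu p] enters A at one of the
    two stages; if at the first, [push_inside] keeps it there. *)
Lemma push_comp lam mu H G : push lam H -> push mu G ->
  push (fun p => lam p + mu p) (H \o G).
Proof.
move=> Hp Gp; split=> /=.
- by move=> p; rewrite addr_ge0 ?(push_ge0 Hp) ?(push_ge0 Gp).
- have [K K0 HK] := push_lip Hp; have [L L0 HL] := push_lip Gp.
  exists (K + L); first exact: addr_ge0.
  move=> p q; rewrite opprD addrACA mulrDl (le_trans (ler_normD _ _))//.
  exact: lerD.
- by move=> z Xz; apply: (push_stable Hp); apply: (push_stable Gp).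
- have [K K0 HK] := push_bilip Hp; have [L L0 HL] := push_bilip Gp.
  exists (K * L) => [|z z' Xz Xz']; first exact: mulr_ge0.
  have [HL1 HL2] := HL _ _ Xz Xz'.
  have [HK1 HK2] := HK _ _ (push_stable Gp Xz) (push_stable Gp Xz').
  split; first by rewrite (le_trans HK1)// -mulrA ler_wpM2l.
  by rewrite (le_trans HL2)// (mulrC K) -mulrA ler_wpM2l.
- move=> p t Mp lt; rewrite (push_above Gp)//; last first.
    by rewrite (le_trans _ lt)// lerDr (push_ge0 Hp).
  by rewrite (push_above Hp) ?lerBrDr// -addrA -opprD (addrC (mu p)).
- move=> p t Mp t0 tl; have [mt|tm] := leP (mu p) t.
    by rewrite (push_above Gp)//; apply: (push_below Hp); rewrite ?subr_ge0// ltrBlDr.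
  have AG := push_below Gp Mp t0 tm.
  rewrite (@lshape_A (G (p, t)))//; first exact: (push_inside Hp).
  by apply: (push_stable Gp); right.
- move=> p Ap; have AG := push_inside Gp Ap.
  rewrite (@lshape_A (G (p, 0)))//; first exact: (push_inside Hp).
  by apply: (push_stable Gp); left.
Qed.

(* (a, b) are the coordinates of a chart, straightening M to b = 0 and A to b < 0;
   psi is its inverse. *)
Record half_chart (W : normedModType R) (x : V) (r L : R) (U : set V) (Y : set W)
    (a : V -> W) (b : V -> R) (psi : W -> R -> V) : Prop := HalfChart {
  chart_r : 0 < r;
  chart_L : 0 <= L;
  chart_nbhs : forall p, A p \/ M p -> `|p - x| < r -> U p;
  chart_sub : forall p, U p -> A p \/ M p;
  chart_Y : forall p, U p -> Y (a p);
  chart_b : forall p, U p -> -1 <= b p <= 0;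
  chart_M : forall p, U p -> M p <-> b p = 0;
  chart_psi : forall p, U p -> psi (a p) (b p) = p;
  chart_U : forall w s, Y w -> -1 <= s <= 0 -> U (psi w s);
  chart_a_psi : forall w s, Y w -> -1 <= s <= 0 -> a (psi w s) = w;
  chart_b_psi : forall w s, Y w -> -1 <= s <= 0 -> b (psi w s) = s;
  chart_a_lip : forall p q, U p -> U q -> `|a p - a q| <= L * `|p - q|;
  chart_b_lip : forall p q, U p -> U q -> `|b p - b q| <= L * `|p - q|;
  chart_psi_lip : forall w w' s s', Y w -> Y w' -> -1 <= s <= 0 -> -1 <= s' <= 0 ->
    `|psi w s - psi w' s'| <= L * (`|w - w'| + `|s - s'|) }.

(** * The push supported in one chart *)

Section ChartPush.
Variables (W : normedModType R) (x : V) (r L : R) (U : set V) (Y : set W).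
Variables (a : V -> W) (b : V -> R) (psi : W -> R -> V).
Hypothesis C : half_chart x r L U Y a b psi.
Variable e : R.
Hypotheses (e_gt0 : 0 < e) (e_half : 2 * e <= 1) (e_small : e + L * (2 * e) < r / 2).

(** Tent with peak [e] at the centre [x], vanishing at distance [e] and beyond. *)
Definition bump (p : V) : R := Num.max 0 (e - `|p - x|).

(** Boundary point on the vertical chart line over [w]. Evaluating the bump there makes the
    displacement parameter constant along each such line. *)
Definition foot (w : W) : V := psi w 0.

(** Vertical coordinate along both arms of the L-shape: [z.2] vanishes on the A part and [b] on the
    M part. *)
Definition height (z : V * R) : R := b z.1 + z.2.

(** Inverse of the coordinates [a] and [height]: negative [s] descends into the chart, positive [s]
    climbs the collar. *)
Definition glue (w : W) (s : R) : V * R := (psi w (Num.min s 0), Num.max s 0).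

Definition chart_push (z : V * R) : V * R :=
  if pselect (U z.1) then glue (a z.1) (slide e (bump (foot (a z.1))) (height z))
  else z.

Lemma bumpP p : 0 <= bump p <= e.
Proof. by rewrite /bump le_max lexx /= ge_max ltW//= gerBl. Qed.

Lemma bump_lip p q : `|bump p - bump q| <= `|p - q|.
Proof.
have := ler_distD q p x; have := ler_distD p q x; rewrite (distrC q p) ler_norml /bump.
have := normr_ge0 (p - q).
move: `|p - q| `|p - x| `|q - x| => u v w.
by case: (leP 0 (e - v)); case: (leP 0 (e - w)) => *; lra.
Qed.

Lemma bump_eq0 p : e <= `|p - x| -> bump p = 0.
Proof. by move=> ?; rewrite /bump max_l// subr_le0. Qed.

Lemma bump_near p : bump p != 0 -> `|p - x| < e.
Proof. by move=> h; rewrite ltNge; apply: contra h => /bump_eq0 ->. Qed.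

Lemma min0P (s : R) : -1 <= s -> -1 <= Num.min s 0 <= 0.
Proof. by move=> s1; rewrite le_min s1 ge_min lexx orbT andbT/=; lra. Qed.

Lemma zeroP : -1 <= (0 : R) <= 0.
Proof. by rewrite lexx andbT; lra. Qed.

Lemma glue_lip w w' s s' : Y w -> Y w' -> -1 <= s -> -1 <= s' ->
  dist1 (glue w s) (glue w' s') <= (L + 1) * (`|w - w'| + `|s - s'|).
Proof.
move=> Yw Yw' s1 s1'; rewrite /dist1 /= mulrDl mul1r lerD//; last first.
  rewrite (@le_trans _ _ `|s - s'|) ?lerDr// ler_norml.
  have := ler_norm (s - s'); have := ler_norm (s' - s); rewrite (distrC s').
  by case: (leP s 0); case: (leP s' 0) => *; lra.
rewrite (le_trans (chart_psi_lip C _ _ _ _)) ?min0P// ler_wpM2l ?(chart_L C)// lerD2l.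
rewrite ler_norml.
have := ler_norm (s - s'); have := ler_norm (s' - s); rewrite (distrC s').
by case: (leP s 0); case: (leP s' 0) => *; lra.
Qed.

Lemma height_ge z : U z.1 -> lshape z -> -1 <= height z.
Proof.
move=> Uz Xz; have /andP[b1 b2] := chart_b C Uz.
by case: Xz => -[_ h]; rewrite /height; lra.
Qed.

Lemma glueK z : U z.1 -> lshape z -> glue (a z.1) (height z) = z.
Proof.
case: z => p t /= Up Xz; have /andP[b1 b2] := chart_b C Up; rewrite /glue /height /=.
case: Xz => -[/= h1 h2].
  by rewrite h2 addr0 min_l ?max_r ?(chart_psi C).
by have bp := (chart_M C Up).1 h1; rewrite bp add0r min_r// max_l// -bp (chart_psi C).
Qed.

Lemma glue_lshape w s : Y w -> -1 <= s -> lshape (glue w s).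
Proof.
move=> Yw s1; have [s0|s0] := leP s 0; last first.
  right; rewrite /glue /= min_r ?max_l ?ltW//; split=> //.
  by apply: ((chart_M C (chart_U C Yw zeroP)).2); rewrite (chart_b_psi C) ?zeroP.
rewrite /glue min_l// max_r//; have s10 : -1 <= s <= 0 by rewrite s1.
have [Ap|Mp] := chart_sub C (chart_U C Yw s10); first by left.
by right.
Qed.

Lemma glue_A w s : Y w -> -1 <= s < 0 -> A (glue w s).1.
Proof.
move=> Yw /andP[s1 s0]; have s10 : -1 <= s <= 0 by rewrite s1 ltW.
rewrite /glue /= min_l ?ltW//.
have [//|Mp] := chart_sub C (chart_U C Yw s10).
have := (chart_M C (chart_U C Yw s10)).1 Mp.
by rewrite (chart_b_psi C)// => s0'; move: s0; rewrite s0' ltxx.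
Qed.

Lemma coord_lip z z' : U z.1 -> U z'.1 ->
  `|a z.1 - a z'.1| + `|height z - height z'| <= (2 * L + 1) * dist1 z z'.
Proof.
move=> Uz Uz'; have := chart_a_lip C Uz Uz'; have := chart_b_lip C Uz Uz'.
have : `|height z - height z'| <= `|b z.1 - b z'.1| + `|z.2 - z'.2|.
  by rewrite /height opprD addrACA ler_normD.
have := mulr_ge0 (chart_L C) (normr_ge0 (z.2 - z'.2)); have := normr_ge0 (z.1 - z'.1).
rewrite /dist1; lra.
Qed.

Lemma foot_lip w w' : Y w -> Y w' -> `|foot w - foot w'| <= L * `|w - w'|.
Proof.
move=> Yw Yw'; have := chart_psi_lip C Yw Yw' zeroP zeroP.
by rewrite subrr normr0 addr0.
Qed.

Lemma slide_ge s p : -1 <= s -> -1 <= slide e (bump p) s.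
Proof.
move=> s1; have [se|se] := leP s (- (2 * e)); first by rewrite slide_low.
by rewrite (le_trans _ (slide_lower e_gt0 (bumpP p) (ltW se)))// lerN2.
Qed.

Lemma glue_coord w s : Y w -> -1 <= s ->
  [/\ U (glue w s).1, a (glue w s).1 = w & height (glue w s) = s].
Proof.
move=> Yw s1; have m0 := min0P s1; rewrite /glue /height /=.
split; [exact: (chart_U C) | exact: (chart_a_psi C) |].
by rewrite (chart_b_psi C)// addr_min_max addr0.
Qed.

Lemma chart_pushE z : U z.1 ->
  chart_push z = glue (a z.1) (slide e (bump (foot (a z.1))) (height z)).
Proof. by rewrite /chart_push; case: pselect. Qed.

Lemma chart_push_out z : ~ U z.1 -> chart_push z = z.
Proof. by rewrite /chart_push; case: pselect. Qed.

(** The bump at the foot is [L]-Lipschitz in the chart coordinate. By [slide_perturb] the height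
    difference thus changes by at most [L * u] plus half of itself, and this half can be absorbed
    for the reverse inequality. *)
Lemma slide_coord z z' : U z.1 -> U z'.1 ->
  let t := slide e (bump (foot (a z.1))) (height z) in
  let t' := slide e (bump (foot (a z'.1))) (height z') in
  let u := `|a z.1 - a z'.1| in
  u + `|t - t'| <= (2 * L + 3) * (u + `|height z - height z'|) /\
  u + `|height z - height z'| <= (2 * L + 3) * (u + `|t - t'|).
Proof.
move=> Uz Uz' t t' u.
have := slide_perturb e_gt0 (height z) (height z') (bumpP (foot (a z.1)))
  (bumpP (foot (a z'.1))); rewrite -/t -/t'.
have := le_trans (bump_lip _ _) (foot_lip (chart_Y C Uz) (chart_Y C Uz')).
rewrite -/u; move: `|bump _ - bump _| => l.
have := ler_normD (t - t' - (height z - height z')) (height z - height z').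
have := ler_normB (t - t') (t - t' - (height z - height z')).
rewrite subrK subKr.
move: `|t - t' - _| => d; have : 0 <= u by rewrite /u.
have := normr_ge0 (t - t'); move: `|t - t'| => v.
have := normr_ge0 (height z - height z'); move: `|height z - height z'| => s.
move: u => u s0 v0 u0 h1 h2 h3 h4.
have := mulr_ge0 (chart_L C) u0; have := mulr_ge0 (chart_L C) s0.
have := mulr_ge0 (chart_L C) v0.
by split; lra.
Qed.

(* In the chart the push is (w, s) |-> (w, slide s): the slide is a perturbation of
   the identity with slope at least 1/2 in s, hence is bi-Lipschitz. *)
Lemma chart_push_bilip_in : exists2 K, 0 <= K & forall z z', lshape z -> lshape z' ->
  U z.1 -> U z'.1 ->
  dist1 (chart_push z) (chart_push z') <= K * dist1 z z' /\
  dist1 z z' <= K * dist1 (chart_push z) (chart_push z').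
Proof.
have L_ge0 := (chart_L C).
have L1 : 0 <= L + 1 by lra.
have L2 : 0 <= 2 * L + 1 by lra.
have L3 : 0 <= 2 * L + 3 by lra.
exists ((L + 1) * ((2 * L + 3) * (2 * L + 1))) => [|z z' Xz Xz' Uz Uz'].
  by rewrite !mulr_ge0.
have [h1 h2] := slide_coord Uz Uz'.
move: h1 h2; rewrite !chart_pushE//=.
set t := slide _ _ (height z); set t' := slide _ _ (height z') => h1 h2.
have t1 : -1 <= t by rewrite slide_ge// height_ge.
have t'1 : -1 <= t' by rewrite slide_ge// height_ge.
have Yz := chart_Y C Uz; have Yz' := chart_Y C Uz'.
have hz := height_ge Uz Xz; have hz' := height_ge Uz' Xz'.
rewrite -!mulrA; split.
  apply: (le_trans (glue_lip Yz Yz' t1 t'1)); rewrite ler_wpM2l ?(chart_L C)//.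
  by apply: (le_trans h1); rewrite ler_wpM2l ?(chart_L C)// coord_lip.
rewrite -{1}(glueK Uz Xz) -{1}(glueK Uz' Xz').
apply: (le_trans (glue_lip Yz Yz' hz hz')); rewrite ler_wpM2l ?(chart_L C)//.
apply: (le_trans h2); rewrite ler_wpM2l ?(chart_L C)//.
have [Ug ag hg] := glue_coord Yz t1; have [Ug' ag' hg'] := glue_coord Yz' t'1.
by have := coord_lip Ug Ug'; rewrite ag ag' hg hg'.
Qed.

Lemma chart_push_dist z : lshape z -> dist1 (chart_push z) z <= (L + 1) * e.
Proof.
move=> Xz; have L1 : 0 <= L + 1 by have := (chart_L C); lra.
have Le : 0 <= (L + 1) * e by rewrite mulr_ge0// ltW.
have [Uz|nUz] := pselect (U z.1); last by rewrite chart_push_out// dist1xx.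
rewrite chart_pushE// -[X in dist1 _ X](glueK Uz Xz).
have hz := height_ge Uz Xz; have Yz := chart_Y C Uz.
rewrite (le_trans (glue_lip Yz Yz (slide_ge _ hz) hz))// subrr normr0 add0r.
by rewrite ler_wpM2l ?slide_dist ?bumpP.
Qed.

(** The foot is within [e] of [x], and descending by at most [2e] in the chart costs at most
    [L * (2e)] in V; [e_small] bounds the total. *)
Lemma glue_near w s : Y w -> -1 <= s -> - (2 * e) <= s ->
  `|foot w - x| < e -> `|(glue w s).1 - x| < r / 2.
Proof.
move=> Yw s1 se fx; apply: le_lt_trans e_small.
rewrite (le_trans (ler_distD (foot w) _ _))// addrC lerD//; first exact: ltW.
rewrite /glue /foot /= (le_trans (chart_psi_lip C _ _ (min0P s1) zeroP))//.
rewrite ler_wpM2l ?(chart_L C)//.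
rewrite subrr normr0 add0r subr0 ler0_norm ?ge_min ?lexx ?orbT//.
by rewrite lerNl le_min se/= oppr_le0 mulr_ge0// ltW.
Qed.

(** A point moves only if the bump at its foot is non-zero and its height exceeds [- 2e]. The slide
    keeps the foot and a height of at least [- 2e], so [glue_near] covers source and image. *)
Lemma chart_push_near z : lshape z -> chart_push z = z \/
  `|z.1 - x| < r / 2 /\ `|(chart_push z).1 - x| < r / 2.
Proof.
move=> Xz; have [Uz|nUz] := pselect (U z.1); last by left; rewrite chart_push_out.
have hz := height_ge Uz Xz; have Yz := chart_Y C Uz; rewrite chart_pushE//.
have [B0|Bn0] := eqVneq (bump (foot (a z.1))) 0.
  by left; rewrite B0 slide0 glueK.
have [se|/ltW se] := leP (height z) (- (2 * e)).
  by left; rewrite slide_low// glueK.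
right; rewrite -{1}(glueK Uz Xz) !glue_near// ?bump_near// ?slide_ge//.
by rewrite slide_lower// bumpP.
Qed.

Lemma chart_push_bilip : exists2 K, 0 <= K & forall z z', lshape z -> lshape z' ->
  dist1 (chart_push z) (chart_push z') <= K * dist1 z z' /\
  dist1 z z' <= K * dist1 (chart_push z) (chart_push z').
Proof.
(* Points outside U lie at distance at least r / 2 from the moved points, and the
   displacement is at most D, so distances to them change by a bounded factor. *)
have [K K0 HK] := chart_push_bilip_in.
pose D := (L + 1) * e; have D0 : 0 <= D.
  by rewrite mulr_ge0 ?ltW// ltr_wpDl ?(chart_L C).
pose K' := K + 1 + D / (r / 2).
have r2 : 0 < r / 2 by rewrite divr_gt0 ?(chart_r C).
have rD : D / (r / 2) * (r / 2) = D by rewrite divfK// gt_eqF.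
have Dr0 : 0 <= D / (r / 2) by rewrite divr_ge0// ltW.
have far z z' : lshape z -> lshape z' -> ~ U z'.1 ->
    dist1 (chart_push z) (chart_push z') <= K' * dist1 z z' /\
    dist1 z z' <= K' * dist1 (chart_push z) (chart_push z').
  move=> Xz Xz' nUz'; rewrite (chart_push_out nUz').
  have [->|[zx hx]] := chart_push_near Xz.
    have d0 := dist1_ge0 z z'.
    suff : dist1 z z' <= K' * dist1 z z' by [].
    by rewrite ler_peMl// /K' -addrA addrCA lerDl addr_ge0.
  have z'x : r <= `|z'.1 - x|.
    rewrite leNgt; apply/negP => h; apply: nUz'; apply: (chart_nbhs C) => //.
    by case: Xz' => -[]; [left|right].
  have near (w : V * R) : `|w.1 - x| < r / 2 -> r / 2 <= dist1 w z'.
    move=> wx; have := ler_distD w.1 z'.1 x; rewrite (distrC z'.1 w.1) /dist1.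
    have := normr_ge0 (w.2 - z'.2); lra.
  have step d d' : r / 2 <= d -> d' <= D + d -> d' <= K' * d.
    move=> rd dd'; rewrite (le_trans dd')// /K' !mulrDl mul1r.
    have : D <= D / (r / 2) * d by rewrite -{1}rD ler_wpM2l.
    have : 0 <= K * d by rewrite mulr_ge0// (le_trans (ltW r2)).
    lra.
  have Hd := chart_push_dist Xz.
  split; apply: step; rewrite ?near//.
    by rewrite (le_trans (dist1_triangle z _ _))// lerD2r.
  by rewrite (le_trans (dist1_triangle (chart_push z) _ _))// lerD2r dist1C.
exists K' => [|z z' Xz Xz']; first by rewrite !addr_ge0.
have [Uz|nUz] := pselect (U z.1); last first.
  by rewrite dist1C (dist1C z); exact: far.
have [Uz'|nUz'] := pselect (U z'.1); last exact: far.
have [h1 h2] := HK _ _ Xz Xz' Uz Uz'.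
have KK' d : 0 <= d -> K * d <= K' * d.
  by move=> d0; rewrite ler_wpM2r// /K' -addrA lerDl addr_ge0.
by split; [apply: (le_trans h1) | apply: (le_trans h2)]; exact/KK'/dist1_ge0.
Qed.

Lemma footK p : U p -> M p -> foot (a p) = p.
Proof. by move=> Up Mp; rewrite /foot -((chart_M C Up).1 Mp) (chart_psi C). Qed.

Lemma bump_out p : M p -> ~ U p -> bump p = 0.
Proof.
move=> Mp nUp; apply: bump_eq0; rewrite leNgt; apply/negP => h; apply: nUp.
apply: (chart_nbhs C); [by right|rewrite (lt_trans h)//].
have : 0 <= L * (2 * e) by rewrite !mulr_ge0 ?(chart_L C)// ltW.
by have := e_small; have := (chart_r C); lra.
Qed.

Lemma chart_push_push : push bump chart_push.
Proof.
split.
- by move=> p; case/andP: (bumpP p).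
- by exists 1 => // p q; rewrite mul1r bump_lip.
- move=> z Xz; have [Uz|nUz] := pselect (U z.1); last by rewrite chart_push_out.
  rewrite chart_pushE//; apply: glue_lshape; first exact: (chart_Y C).
  by rewrite slide_ge// height_ge.
- exact: chart_push_bilip.
- move=> p t Mp bt; have t0 : 0 <= t by case/andP: (bumpP p) => /le_trans->.
  have [Up|nUp] := pselect (U p); last by rewrite chart_push_out// bump_out// subr0.
  rewrite chart_pushE//= /height /= footK// ((chart_M C Up).1 Mp) add0r slide_ge0//.
  by rewrite /glue min_r ?max_l ?subr_ge0//; rewrite -/(foot _) footK.
- move=> p t Mp t0 tb; have [Up|nUp] := pselect (U p); last first.
    by move: tb; rewrite bump_out// ltNge t0.
  rewrite chart_pushE//= /height /= footK// ((chart_M C Up).1 Mp) add0r.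
  apply: glue_A; first exact: (chart_Y C).
  by rewrite slide_ge ?(le_trans _ t0)//= ?slide_ge0// subr_lt0.
- move=> p Ap; have [Up|nUp] := pselect (U p); last by rewrite chart_push_out.
  rewrite chart_pushE//=; apply: glue_A; first exact: (chart_Y C).
  (* Points of A have negative height, as height 0 would put them on M, and the slide only lowers
     them. *)
  have /andP[b1 b0] := chart_b C Up.
  rewrite slide_ge /height /= ?addr0//= (le_lt_trans (slide_le _ _ _))//.
    by case/andP: (bumpP (foot (a p))).
  rewrite lt_neqAle b0 andbT; apply/eqP => /(chart_M C Up).2 Mp.
  by have : (A `&` M) p by []; rewrite AM.
Qed.

End ChartPush.

(** * Global pushes by compactness, and the one-sided collar *)

Definition collarable (x : V) : Prop :=
  exists (W : normedModType R) r L U (Y : set W) a b psi,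
    half_chart x r L U Y a b psi.

Lemma local_push x : collarable x ->
  exists2 e, 0 < e & exists H, push (bump x e) H.
Proof.
move=> [W [r [L [U [Y [a [b [psi C]]]]]]]].
have r0 := chart_r C; have L0 := chart_L C.
(* The bound 1/2 keeps the band [[-2e, 0]] inside the chart; the other makes [e + L * (2e)] at most
   [r / 4]. *)
pose e := Num.min (1 / 2) (r / (4 * (1 + 2 * L))).
have L1 : 0 < 4 * (1 + 2 * L) by lra.
have e0 : 0 < e by rewrite lt_min divr_gt0//= divr_gt0.
have e1 : 2 * e <= 1.
  have : e <= 1 / 2 by rewrite ge_min lexx.
  lra.
have e2 : e + L * (2 * e) < r / 2.
  have : e <= r / (4 * (1 + 2 * L)) by rewrite ge_min lexx orbT.
  rewrite ler_pdivlMr// => h; lra.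
by exists e => //; exists (chart_push x U a b psi e); exact: (chart_push_push C e0 e1 e2).
Qed.

(** On the ball of radius [e x / 2] the tent is at least half its peak. Finitely many such balls
    cover M, and composing their pushes adds non-negative drops, so on M the sum is at least one of
    the half peaks. *)
Lemma compact_push : compact M -> (forall x, M x -> collarable x) ->
  exists lam H c, [/\ push lam H, 0 < c & forall p, M p -> c <= lam p].
Proof.
move=> cM charts.
have /choice[e eP] x : exists e, 0 < e /\ (M x -> exists H, push (bump x e) H).
  (* Off M the radius 1 is a mere default for the choice function. *)
  have [Mx|nMx] := pselect (M x); last by exists 1.
  by have [e e0 [H HP]] := local_push (charts x Mx); exists e; split=> // _; exists H.
have seqP (s : seq V) : (forall x, x \in s -> M x) ->
    exists lam H c, [/\ push lam H, 0 < c &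
      forall p x, x \in s -> ball x (e x / 2) p -> c <= lam p].
  elim: s => [|x s IHs] sM.
    by exists (fun=> 0), id, 1; split=> //; exact: push_id.
  have [y ys|lam [H [c [HP c0 cP]]]] := IHs; first by apply: sM; rewrite in_cons ys orbT.
  have [ex /(_ (sM x (mem_head _ _)))[G GP]] := eP x.
  exists (fun p => bump x (e x) p + lam p), (G \o H), (Num.min c (e x / 2)).
  split; first exact: push_comp.
    by rewrite lt_min c0 divr_gt0.
  move=> p y; rewrite in_cons => /predU1P[->|ys] py.
    rewrite ge_min; apply/orP; right; apply: le_trans (_ : bump x (e x) p <= _).
      move: py; rewrite -ball_normE /= distrC => py.
      by rewrite /bump le_max; apply/orP; right; lra.
    by rewrite lerDl (push_ge0 HP).
  rewrite ge_min; apply/orP; left; apply: le_trans (cP _ _ ys py) _.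
  by rewrite lerDr (push_ge0 GP).
move: cM; rewrite compact_cover => /(_ V M (fun x => ball x (e x / 2))).
case=> [x _|p Mp|D DM MD].
- exact: ball_open.
- by exists p => //; apply: ballxx; rewrite divr_gt0//; case: (eP p).
have [|lam [H [c [HP c0 cP]]]] := seqP (finmap.enum_fset D).
  by move=> x /DM; rewrite inE.
exists lam, H, c; split=> // p /MD[x /= xD px]; exact: cP px.
Qed.

Lemma one_sided_collar : compact M -> (forall x, M x -> collarable x) ->
  exists (f : V -> R -> V) (K : R), [/\ 0 <= K, forall x, M x -> f x 0 = x,
    forall x t, M x -> 0 < t <= 1 -> A (f x t) &
    forall x y s t, M x -> M y -> 0 <= s <= 1 -> 0 <= t <= 1 ->
      `|f x s - f y t| <= K * (`|x - y| + `|s - t|) /\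
      `|x - y| + `|s - t| <= K * `|f x s - f y t|].
Proof.
move=> cM /(compact_push cM)[lam [H [c [HP c0 lamc]]]].
have [K K0 HK] := push_bilip HP; have [L L0 HL] := push_lip HP.
(* The height starts at [lam x], which [H] sends to 0, then decreases, so that [H] maps into A;
   [c <= lam x] keeps it non-negative up to time 1. *)
pose z x t := (x, lam x - c * t).
have zX x t : M x -> 0 <= t <= 1 -> lshape (z x t).
  move=> Mx /andP[t0 t1]; right; split=> //=; rewrite subr_ge0 (le_trans _ (lamc x Mx))//.
  by rewrite ger_pMr.
have z0 x : M x -> H (z x 0) = (x, 0).
  by move=> Mx; rewrite /z mulr0 subr0 (push_above HP)// subrr.
have zA x t : M x -> 0 < t <= 1 -> A (H (z x t)).1.
  move=> Mx /andP[t0 t1]; apply: (push_below HP) => //; last first.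
    by rewrite ltrBlDr ltrDl mulr_gt0.
  have [] := zX x t Mx; [by rewrite ltW| |by case].
  by case=> /= Ax; have : (A `&` M) x by []; rewrite AM.
(* Images have height 0, so passing to the first component loses no distance. *)
have zH x t : M x -> 0 <= t <= 1 -> (H (z x t)).2 = 0.
  move=> Mx t01; have /andP[t0 t1] := t01.
  have [->|tn0] := eqVneq t 0; first by rewrite z0.
  have Az : A (H (z x t)).1 by apply: zA => //; rewrite lt_neqAle eq_sym tn0 t0.
  by rewrite (lshape_A (push_stable HP (zX _ _ Mx t01)) Az).
(* The first summand serves the upper bound, the second the lower one. *)
exists (fun x t => (H (z x t)).1), (K * (1 + L + c) + (1 + (1 + L) / c) * K).
have Lc : 0 <= 1 + L + c by rewrite !addr_ge0// ltW.
have Lc' : 0 <= 1 + (1 + L) / c by rewrite addr_ge0// divr_ge0 ?addr_ge0// ltW.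
split=> //; first by rewrite addr_ge0// mulr_ge0.
- by move=> x Mx; rewrite z0.
move=> x y s t Mx My s01 t01.
have [h1 h2] := HK _ _ (zX _ _ Mx s01) (zX _ _ My t01).
have dE : dist1 (H (z x s)) (H (z y t)) = `|(H (z x s)).1 - (H (z y t)).1|.
  by rewrite /dist1 !zH// subrr normr0 addr0.
move: h1 h2; rewrite dE; set d := `|_ - _|; set d' := dist1 _ _ => h1 h2.
have d0 : 0 <= d by exact: normr_ge0.
have d'0 : 0 <= d' by exact: dist1_ge0.
have hl := HL x y.
have e1 : d' <= (1 + L + c) * (`|x - y| + `|s - t|).
  have : `|lam x - c * s - (lam y - c * t)| <= `|lam x - lam y| + c * `|s - t|.
    have -> : lam x - c * s - (lam y - c * t) = (lam x - lam y) - c * (s - t) by lra.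
    by rewrite (le_trans (ler_normB _ _))// normrM (gtr0_norm c0).
  have : 0 <= L * `|s - t| by rewrite mulr_ge0.
  have : 0 <= c * `|x - y| by rewrite mulr_ge0// ltW.
  rewrite /d' /dist1 /=; have := normr_ge0 (s - t); lra.
have e2 : `|x - y| + `|s - t| <= (1 + (1 + L) / c) * d'.
  (* [c * (s - t)] is recovered from the difference of heights and that of [lam], which is
     [L]-Lipschitz. *)
  have : c * `|s - t| <= (1 + L) * d'.
    have -> : c * `|s - t| = `|(lam x - lam y) - (lam x - c * s - (lam y - c * t))|.
      by rewrite -(gtr0_norm c0) -normrM (gtr0_norm c0); congr `|_|; lra.
    rewrite (le_trans (ler_normB _ _))// /d' /dist1 /=.
    have : 0 <= L * `|lam x - c * s - (lam y - c * t)| by rewrite mulr_ge0.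
    have := normr_ge0 (x - y); lra.
  rewrite -ler_pdivlMl// mulrC mulrAC => h; rewrite mulrDl mul1r lerD//.
  by rewrite /d' /dist1 /= lerDl.
split.
  rewrite mulrDl; apply: (@le_trans _ _ (K * (1 + L + c) * (`|x - y| + `|s - t|))).
    by rewrite (le_trans h1)// -mulrA ler_wpM2l.
  by rewrite lerDl !mulr_ge0// addr_ge0.
rewrite mulrDl; apply: (@le_trans _ _ ((1 + (1 + L) / c) * K * d)).
  by rewrite (le_trans e2)// -mulrA ler_wpM2l.
by rewrite lerDr !mulr_ge0.
Qed.

End OneSide.

(** * Gluing the collars of the two sides *)

(** All points of the segment satisfy the inequality. If none were on the boundary, the parameters
    mapped into [O] would be a non-empty clopen part of [[0, 1]], hence everything, and [q] would
    lie in [O]. *)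
Lemma segment_meets_bdry (R : realType) (V : normedModType R) (O : set V) (p q : V) :
  open O -> O p -> ~ closure O q ->
  exists2 m, bdry O m & `|p - m| + `|m - q| <= `|p - q|.
Proof.
move=> openO Op nOq; apply: contrapT => nom.
pose f (t : R) : V := p + t *: (q - p).
have fc : continuous f.
  by move=> t; apply: cvgD; [exact: cvg_cst | apply: cvgZr_tmp; exact: cvg_id].
have bO t : 0 <= t <= 1 -> closure O (f t) -> O (f t).
  move=> /andP[t0 t1] clO; apply: contrapT => nO; apply: nom; exists (f t).
    by split=> //; rewrite ((interior_id _).1 openO).
  have -> : p - f t = t *: (p - q) by rewrite /f opprD addrA subrr add0r -scalerN opprB.
  have -> : f t - q = (1 - t) *: (p - q).
    by rewrite /f -(opprB p q) scalerN addrAC scalerBl scale1r.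
  by rewrite !normrZ -mulrDl !ger0_norm ?subr_ge0// addrC subrK mul1r.
have f0 : f 0 = p by rewrite /f scale0r addr0.
have f1 : f 1 = q by rewrite /f scale1r addrC subrK.
suff : (`[0, 1] `&` f @^-1` O) (1 : R) by case=> _ /=; rewrite f1 => /subset_closure.
rewrite (_ : _ `&` _ = `[0, 1]%classic); first by rewrite /= in_itv /= lexx ler01.
apply: segment_connected.
- by exists 0; rewrite /= f0 in_itv /= lexx ler01.
- by exists (f @^-1` O) => //; apply: open_comp => // t _; exact: fc.
- exists (f @^-1` closure O).
    by apply: closed_comp => [t _|]; [exact: fc | exact: closed_closure].
  apply/seteqP; split=> t /= [t01 Ot]; split=> //; first exact: subset_closure.
  by apply: bO => //; move: t01; rewrite in_itv.
Qed.

Lemma two_sided_collar (R : realType) (V : normedModType R) (O : set V) :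
  open O -> compact (bdry O) ->
  (forall x, bdry O x -> collarable O (bdry O) x) ->
  (forall x, bdry O x -> collarable (~` closure O) (bdry O) x) ->
  exists (F : V -> R -> V) (K : R), [/\ 0 <= K, forall x, bdry O x -> F x 0 = x,
    forall x t, bdry O x -> -1 <= t < 0 -> O (F x t),
    forall x t, bdry O x -> 0 < t <= 1 -> (~` closure O) (F x t) &
    forall x y s t, bdry O x -> bdry O y -> -1 <= s <= 1 -> -1 <= t <= 1 ->
      `|F x s - F y t| <= K * (`|x - y| + `|s - t|) /\
      `|x - y| + `|s - t| <= K * `|F x s - F y t|].
Proof.
move=> openO cM chO chC.
have OM : O `&` bdry O = set0.
  by rewrite -subset0 => x [Ox [_]]; rewrite ((interior_id _).1 openO).
have CM : (~` closure O) `&` bdry O = set0.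
  by rewrite -subset0 => x [nx [cx _]].
have [f [K [K0 f0 fO fK]]] := one_sided_collar OM cM chO.
have [g [L [L0 g0 gC gL]]] := one_sided_collar CM cM chC.
(* The inner collar with time reversed, followed by the outer one; both give [x] at time 0. *)
pose F x t := if t <= 0 then f x (- t) else g x t.
have Fneg x t : t <= 0 -> F x t = f x (- t) by rewrite /F => ->.
have Fpos x t : bdry O x -> 0 <= t -> F x t = g x t.
  move=> Mx; rewrite le_eqVlt => /predU1P[<-|t0]; last by rewrite /F leNgt t0.
  by rewrite /F lexx oppr0 f0// g0.
have FO x t : bdry O x -> -1 <= t < 0 -> O (F x t).
  by move=> Mx /andP[t1 t0]; rewrite (Fneg _ _ (ltW t0)); apply: fO => //; lra.
have FC x t : bdry O x -> 0 < t <= 1 -> (~` closure O) (F x t).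
  by move=> Mx t01; have /andP[t0 _] := t01; rewrite (Fpos _ _ Mx (ltW t0)); exact: gC.
have mono k d d' : 0 <= d -> 0 <= k -> k <= K + L -> d' <= k * d -> d' <= (K + L) * d.
  by move=> d0 k0 kKL h; apply: le_trans h _; rewrite ler_wpM2r.
(* A segment from O to the complement of its closure crosses the boundary, which
   reduces the lower bound across sides to the one-sided bounds. *)
have mixed x y s t : bdry O x -> bdry O y -> -1 <= s <= 1 -> -1 <= t <= 1 ->
    s < 0 -> 0 < t ->
    `|F x s - F y t| <= (K + L) * (`|x - y| + `|s - t|) /\
    `|x - y| + `|s - t| <= (K + L) * `|F x s - F y t|.
  move=> Mx My /andP[s1 _] /andP[_ t1] s0 t0.
  rewrite (Fneg _ _ (ltW s0)) (Fpos _ _ My (ltW t0)).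
  have z01 : 0 <= (0 : R) <= 1 by rewrite lexx ler01.
  have s01 : 0 <= - s <= 1 by lra.
  have t01 : 0 <= t <= 1 by lra.
  have st : `|s - t| = - s + t by rewrite ltr0_norm//; lra.
  rewrite st; split.
    (* The upper bound passes through [x], the time 0 point of both collars. *)
    have [] := fK x x (- s) 0 Mx Mx s01 z01; rewrite f0// subrr normr0 add0r subr0.
    rewrite (gtr0_norm (_ : 0 < - s)) ?oppr_gt0// => h1 _.
    have [] := gL x y 0 t Mx My z01 t01; rewrite g0// sub0r normrN (gtr0_norm t0) => h2 _.
    have := ler_distD x (f x (- s)) (g y t).
    have : 0 <= K * (`|x - y| + t) by rewrite mulr_ge0// addr_ge0// ltW.
    have : 0 <= L * - s by rewrite mulr_ge0//; lra.
    lra.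
  have [|||m Mm mle] := @segment_meets_bdry _ _ O (f x (- s)) (g y t).
  - exact: openO.
  - by apply: fO => //; lra.
  - by apply: gC => //; lra.
  have [_] := fK x m (- s) 0 Mx Mm s01 z01; rewrite f0// subr0.
  rewrite (gtr0_norm (_ : 0 < - s)) ?oppr_gt0// => h1.
  have [_] := gL m y 0 t Mm My z01 t01; rewrite g0// sub0r normrN (gtr0_norm t0) => h2.
  have h3 := ler_distD m x y.
  have : K * (`|f x (- s) - m| + `|m - g y t|) <= K * `|f x (- s) - g y t|.
    by rewrite ler_wpM2l.
  have : L * (`|f x (- s) - m| + `|m - g y t|) <= L * `|f x (- s) - g y t|.
    by rewrite ler_wpM2l.
  have := mulr_ge0 K0 (normr_ge0 (m - g y t)).
  have := mulr_ge0 L0 (normr_ge0 (f x (- s) - m)).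
  lra.
exists F, (K + L); split=> //; first exact: addr_ge0.
  by move=> x Mx; rewrite Fneg// oppr0 f0.
move=> x y s t Mx My s11 t11; have /andP[s1 s2] := s11; have /andP[t1 t2] := t11.
have [s0|s0] := leP s 0; have [t0|t0] := leP t 0.
- rewrite !Fneg//; have [||] := fK x y (- s) (- t) Mx My; try lra.
  rewrite -opprD normrN => h1 h2.
  by split; apply: (mono K); rewrite ?lerDl ?addr_ge0.
- have [sn0|sn0] := ltP s 0; first exact: mixed.
  rewrite (Fpos _ _ Mx sn0) (Fpos _ _ My (ltW t0)).
  have [||] := gL x y s t Mx My; try lra.
  by move=> h1 h2; split; apply: (mono L); rewrite ?lerDr ?addr_ge0.
- have [tn0|tn0] := ltP t 0; last first.
    rewrite (Fpos _ _ Mx (ltW s0)) (Fpos _ _ My tn0).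
    have [||] := gL x y s t Mx My; try lra.
    by move=> h1 h2; split; apply: (mono L); rewrite ?lerDr ?addr_ge0.
  by rewrite (distrC (F x s)) (distrC x) (distrC s); exact: mixed.
- rewrite (Fpos _ _ Mx (ltW s0)) (Fpos _ _ My (ltW t0)).
  have [||] := gL x y s t Mx My; try lra.
  by move=> h1 h2; split; apply: (mono L); rewrite ?lerDr ?addr_ge0.
Qed.

(** * Norms of row vectors, and charts of weakly Lipschitz domains *)

Section RowVectors.
Variable R : realType.

Lemma norm_coord_le m (v : 'rV[R]_m) i : `|v ord0 i| <= `|v|.
Proof.
rewrite [leRHS]/Num.norm /= mx_normrE; apply/bigmax_geP; right => /=.
by exists (ord0, i).
Qed.

Lemma norm_le_coord m (v : 'rV[R]_m) c :
  0 <= c -> (forall i, `|v ord0 i| <= c) -> `|v| <= c.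
Proof.
move=> c0 vc; rewrite [leLHS]/Num.norm /= mx_normrE; apply/bigmax_leP; split=> //=.
by move=> [i j] _ /=; rewrite ord1.
Qed.

Lemma norm_le_enorm m (v : 'rV[R]_m) : `|v| <= enorm v.
Proof.
apply: norm_le_coord => [|i]; first exact: sqrtr_ge0.
rewrite -sqrtr_sqr ler_wsqrtr// (bigD1 i)//= lerDl sumr_ge0// => j _.
exact: sqr_ge0.
Qed.

(** Each of the [m] squares is at most the squared sup norm, and [m <= m ^ 2]. *)
Lemma enorm_le_norm m (v : 'rV[R]_m) : enorm v <= m%:R * `|v|.
Proof.
rewrite /enorm -[leRHS]ger0_norm ?mulr_ge0// -sqrtr_sqr ler_wsqrtr//.
apply: (@le_trans _ _ (\sum_(i < m) `|v| ^+ 2)).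
  apply: ler_sum => i _; rewrite -[leLHS]real_normK ?num_real//.
  by rewrite lerXn2r ?nnegrE ?norm_coord_le.
rewrite sumr_const card_ord exprMn -[leLHS]mulr_natl ler_wpM2r ?exprn_ge0//.
by rewrite -natrX ler_nat; case: (m) => // k; rewrite leq_pmulr.
Qed.

(** Lets all estimates be made in the sup norm, dimension factors going into the constant. *)
Lemma lipschitz_in_norm m k (X : set 'rV[R]_m) (f : 'rV[R]_m -> 'rV[R]_k) :
  lipschitz_in X f <->
  exists2 K, 0 <= K & forall x y, X x -> X y -> `|f x - f y| <= K * `|x - y|.
Proof.
split=> [[L LX]|[K K0 KX]].
  (* [lipschitz_in] puts no sign on [L], hence the maximum with 0. *)
  exists (Num.max 0 L * m%:R) => [|x y Xx Xy].
    by rewrite mulr_ge0// le_max lexx.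
  apply: (le_trans (norm_le_enorm _)); apply: (le_trans (LX x y Xx Xy)).
  apply: (@le_trans _ _ (Num.max 0 L * enorm (x - y))).
    by rewrite ler_wpM2r ?sqrtr_ge0// le_max lexx orbT.
  by rewrite -mulrA ler_wpM2l ?enorm_le_norm// le_max lexx.
exists (k%:R * K) => x y Xx Xy.
apply: (le_trans (enorm_le_norm _)); rewrite -mulrA ler_wpM2l//.
by apply: (le_trans (KX x y Xx Xy)); rewrite ler_wpM2l// norm_le_enorm.
Qed.

(** The sup norm of a pair is the maximum of its parts, which lies between half their sum and their
    sum. *)
Lemma pair_rv_dist m (x y : 'rV[R]_m) (s t : R) :
  `|pair_rv x s - pair_rv y t| <= `|x - y| + `|s - t| /\
  `|x - y| + `|s - t| <= 2 * `|pair_rv x s - pair_rv y t|.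
Proof.
have lE i : (pair_rv x s - pair_rv y t) ord0 (lshift 1 i) = (x - y) ord0 i.
  by rewrite /pair_rv !mxE !(unsplitK (inl i)).
have rE j : (pair_rv x s - pair_rv y t) ord0 (rshift m j) = s - t.
  by rewrite /pair_rv !mxE !(unsplitK (inr j)) !mxE (ord1 j).
split.
  apply: norm_le_coord => [|i]; first exact: addr_ge0.
  case: (split_ordP i) => j ->.
    by rewrite lE (le_trans (norm_coord_le _ j))// lerDl.
  by rewrite rE lerDr.
rewrite mulrDl mul1r lerD// -?(rE ord0) ?norm_coord_le//.
by apply: norm_le_coord => // i; rewrite -lE norm_coord_le.
Qed.

Lemma lsubmx_pair_rv m (x : 'rV[R]_m) t : lsubmx (pair_rv x t) = x.
Proof. exact: row_mxKl. Qed.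

Lemma rsubmx_pair_rv m (x : 'rV[R]_m) t : rsubmx (pair_rv x t) ord0 ord0 = t.
Proof. by rewrite /pair_rv row_mxKr mxE. Qed.

Lemma compact_bdry m (O : set 'rV[R]_m) : bounded_set O -> compact (bdry O).
Proof.
move=> [N [Nreal hN]]; apply: bounded_closed_compact.
  (* A boundary point is within 1 of a point of [O], whose norm is at most [N + 1]. *)
  exists (N + 2); split; first exact: num_real.
  move=> B NB x [clx _].
  have [y [Oy]] := clx _ (nbhsx_ballx x 1 ltr01).
  rewrite -ball_normE /= => xy.
  have := hN (N + 1) _ y Oy; rewrite ltrDl => /(_ ltr01) /= yN.
  by have := ler_distD y x 0; rewrite !subr0; lra.
apply: closedI; first exact: closed_closure.
exact/open_closedC/open_interior.
Qed.

Variable n : nat.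
Implicit Types (w y : 'rV[R]_n.+1).

Definition last_axis : 'rV[R]_n.+1 := delta_mx ord0 ord_max.

(** The cross-section of the cube is kept as a hyperplane of the same space, which avoids reindexing
    coordinates. *)
Definition horizontal y : 'rV[R]_n.+1 := y - y ord0 ord_max *: last_axis.

Lemma last_axisE i : last_axis ord0 i = (i == ord_max)%:R.
Proof. by rewrite mxE. Qed.

Lemma norm_last_axis (c : R) : `|c *: last_axis| <= `|c|.
Proof.
apply: norm_le_coord => // i; rewrite mxE last_axisE.
by case: eqP => _; rewrite ?mulr1 ?mulr0 ?normr0.
Qed.

Lemma horizontal_max y : horizontal y ord0 ord_max = 0.
Proof. by rewrite !mxE !eqxx mulr1 subrr. Qed.

Lemma horizontal_neq y i : i != ord_max -> horizontal y ord0 i = y ord0 i.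
Proof. by move=> /negPf im; rewrite !mxE im andbF mulr0 subr0. Qed.

Lemma horizontal_dist w y : `|horizontal w - horizontal y| <= `|w - y|.
Proof.
apply: norm_le_coord => // i; rewrite mxE [X in _ + X]mxE.
have [->|im] := eqVneq i ord_max; first by rewrite !horizontal_max subrr normr0.
by rewrite !horizontal_neq// (le_trans _ (norm_coord_le _ i))// !mxE.
Qed.

Lemma horizontalK y : horizontal y + y ord0 ord_max *: last_axis = y.
Proof. by rewrite subrK. Qed.

Lemma add_last_axis_max w (c : R) : w ord0 ord_max = 0 ->
  (w + c *: last_axis) ord0 ord_max = c.
Proof. by move=> w0; rewrite !mxE w0 !eqxx mulr1 add0r. Qed.

Lemma add_last_axis_neq w (c : R) i : i != ord_max ->
  (w + c *: last_axis) ord0 i = w ord0 i.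
Proof. by move=> /negPf im; rewrite !mxE im andbF mulr0 addr0. Qed.

(* The sign e turns the side A towards negative last coordinates. *)
Lemma collarable_chart (A M : set 'rV[R]_n.+1) (e : R) x U
    (phi : 'rV[R]_n.+1 -> 'rV[R]_n.+1) :
  `|e| = 1 -> nbhs x U -> biLipschitz_onto U (cube_slab `[-1, 1]) phi ->
  (forall p, U p -> A p <-> -1 <= e * phi p ord0 ord_max < 0) ->
  (forall p, U p -> M p <-> phi p ord0 ord_max = 0) ->
  collarable A M x.
Proof.
move=> e1 /nbhs_ballP[r /= r0 rU] [[phiU _ phiS] philip [g [gK glip]]] AP MP.
have ee : e * e = 1 by rewrite -expr2 -real_normK ?num_real// e1 expr1n.
have e0 : e != 0 by rewrite -normr_gt0 e1.
have [K K0 HK] := (lipschitz_in_norm _ _).1 philip.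
have [L L0 HL] := (lipschitz_in_norm _ _).1 glip.
have phiK y : cube_slab `[-1, 1] y -> U (g y) /\ phi (g y) = y.
  by move=> /phiS[p Up <-]; rewrite gK.
have AMP p : U p -> (A p \/ M p) <-> -1 <= e * phi p ord0 ord_max <= 0.
  move=> Up; split=> [[/(AP p Up).1 /andP[-> /ltW->]//|/(MP p Up).1 ->]|].
    by rewrite mulr0 lexx andbT; lra.
  move=> /andP[h1]; rewrite le_eqVlt => /predU1P[/eqP|h2].
    by rewrite mulf_eq0 (negPf e0) => /eqP /(MP p Up).2; right.
  by left; apply/(AP p Up); rewrite h1.
pose lift w (s : R) : 'rV[R]_n.+1 := w + (e * s) *: last_axis.
have liftP w s : cube_slab [set 0] w -> -1 <= s <= 0 ->
    cube_slab `[-1, 1] (lift w s).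
  move=> [w1 /= w0] s01; split=> [i im|/=].
    by rewrite add_last_axis_neq//; exact: w1.
  by rewrite add_last_axis_max// in_itv /= -ler_norml normrM e1 mul1r ler_norml; lra.
(* The chart is restricted to the half of the cube belonging to A and M; [e * e = 1] makes [lift]
   undo the signed last coordinate. *)
exists 'rV[R]_n.+1, r, (K + L), [set p | U p /\ (A p \/ M p)],
  (cube_slab [set 0]), (horizontal \o phi), (fun p => e * phi p ord0 ord_max),
  (fun w s => g (lift w s)).
split=> //=.
- exact: addr_ge0.
- move=> p AMp px; split=> //; apply: rU; rewrite -ball_normE /= distrC//.
- by move=> p [].
- move=> p [Up _]; have [h _] := phiU _ Up; split; last exact: horizontal_max.
  by move=> i im; rewrite horizontal_neq//; exact: h.
- by move=> p [Up /(AMP p Up)].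
- move=> p [Up _]; rewrite (MP p Up); split=> [->|/eqP]; first by rewrite mulr0.
  by rewrite mulf_eq0 (negPf e0) => /eqP.
- by move=> p [Up _]; rewrite /lift mulrA ee mul1r horizontalK gK.
- move=> w s Yw s01; have [Ug gE] := phiK _ (liftP _ _ Yw s01); split=> //.
  by apply/(AMP _ Ug); rewrite gE add_last_axis_max ?mulrA ?ee ?mul1r//; case: Yw.
- move=> w s Yw s01; have [Ug ->] := phiK _ (liftP _ _ Yw s01).
  by rewrite /horizontal add_last_axis_max ?addrK//; case: Yw.
- move=> w s Yw s01; have [Ug ->] := phiK _ (liftP _ _ Yw s01).
  by rewrite add_last_axis_max ?mulrA ?ee ?mul1r//; case: Yw.
- move=> p q [Up _] [Uq _]; apply: (le_trans (horizontal_dist _ _)).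
  by apply: (le_trans (HK _ _ Up Uq)); rewrite ler_wpM2r// lerDl.
- move=> p q [Up _] [Uq _]; rewrite -mulrBr normrM e1 mul1r.
  have := norm_coord_le (phi p - phi q) ord_max; rewrite mxE [X in _ + X]mxE => h.
  apply: (le_trans h).
  by apply: (le_trans (HK _ _ Up Uq)); rewrite ler_wpM2r// lerDl.
- move=> w w' s s' Yw Yw' s01 s01'.
  apply: (le_trans (HL _ _ (liftP _ _ Yw s01) (liftP _ _ Yw' s01'))).
  apply: (@le_trans _ _ (L * (`|w - w'| + `|s - s'|))).
    rewrite ler_wpM2l// /lift opprD addrACA -scalerBl -mulrBr.
    rewrite (le_trans (ler_normD _ _))// lerD2l (le_trans (norm_last_axis _))//.
    by rewrite normrM e1 mul1r.
  by rewrite ler_wpM2r ?lerDr// addr_ge0.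
Qed.

(** Injectivity of [phi] turns the image equalities into pointwise equivalences on [U]; one chart
    then serves both sides, with opposite signs. *)
Lemma weakly_Lipschitz_collarable (O : set 'rV[R]_n.+1) x :
  weakly_Lipschitz_domain O -> bdry O x ->
  collarable O (bdry O) x /\ collarable (~` closure O) (bdry O) x.
Proof.
move=> [openO charts] /charts[U [phi [_ xU phiB [_ phiO phiM phiC]]]].
have [[phiU phiI _] _ _] := phiB.
have imP (B : set 'rV[R]_n.+1) (J : set R) : J `<=` `[-1, 1]%classic ->
    phi @` (B `&` U) = cube_slab J ->
    forall p, U p -> B p <-> J (phi p ord0 ord_max).
  move=> JI BJ p Up; split=> [Bp|Jp].
    have : (phi @` (B `&` U)) (phi p) by exists p.
    by rewrite BJ => -[].
  have : cube_slab J (phi p) by split=> //; have [] := phiU p Up.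
  rewrite -BJ => -[q [Bq Uq] qp].
  by rewrite -(phiI q p)// inE.
have MP p : U p -> bdry O p <-> phi p ord0 ord_max = 0.
  by apply: imP phiM p => t ->; rewrite /= in_itv /=; lra.
split.
  apply: (@collarable_chart _ _ 1 x U phi) => //; first exact: normr1.
  move=> p Up; rewrite mul1r; have := imP _ _ _ phiO p Up.
  rewrite /= in_itv /=; apply=> t; rewrite /= !in_itv /= => /andP[-> h] /=; lra.
apply: (@collarable_chart _ _ (-1) x U phi) => //; first by rewrite normrN normr1.
move=> p Up; rewrite mulN1r oppr_lt0 lerN2 andbC; have := imP _ _ _ phiC p Up.
rewrite /= in_itv /=; apply=> t; rewrite /= !in_itv /= => /andP[h ->]; rewrite andbT; lra.
Qed.

End RowVectors.

(** * The embedding in coordinates of the cylinder *)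

Theorem theorem2p3 (R : realType) (n : nat) (Omega : set 'rV[R]_n.+1)
    (Omega_bounded : bounded_set Omega)
    (Omega_wLip : weakly_Lipschitz_domain Omega) :
  exists Psi : 'rV[R]_(n.+1 + 1) -> 'rV[R]_n.+1,
    [/\ LIP_embedding (cylinder (bdry Omega) `[-1, 1]) Psi,
        forall x, bdry Omega x -> Psi (pair_rv x 0) = x,
        Psi @` cylinder (bdry Omega) `[-1, 0[ `<=` Omega &
        Psi @` cylinder (bdry Omega) `]0, 1] `<=` ~` closure Omega].
Proof.
have cM := compact_bdry Omega_bounded.
have [F [K [K0 F0 FO FC FK]]] := two_sided_collar Omega_wLip.1 cM
  (fun x Mx => (weakly_Lipschitz_collarable Omega_wLip Mx).1)
  (fun x Mx => (weakly_Lipschitz_collarable Omega_wLip Mx).2).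
pose Psi (z : 'rV[R]_(n.+1 + 1)) := F (lsubmx z) (rsubmx z ord0 ord0).
have PsiE x t : Psi (pair_rv x t) = F x t.
  by rewrite /Psi lsubmx_pair_rv rsubmx_pair_rv.
pose X := cylinder (bdry Omega) `[-1, 1].
(* The two bounds hold on the whole cylinder; the lower one gives injectivity and the Lipschitz
   inverse. *)
have upper z z' : X z -> X z' -> `|Psi z - Psi z'| <= K * 2 * `|z - z'|.
  move=> [x [s [Mx /=]]]; rewrite in_itv /= => s1 ->.
  move=> [y [t [My /=]]]; rewrite in_itv /= => t1 ->; rewrite !PsiE.
  have [h _] := FK x y s t Mx My s1 t1; apply: (le_trans h).
  by rewrite -mulrA ler_wpM2l//; case: (pair_rv_dist x y s t).
have lower z z' : X z -> X z' -> `|z - z'| <= K * `|Psi z - Psi z'|.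
  move=> [x [s [Mx /=]]]; rewrite in_itv /= => s1 ->.
  move=> [y [t [My /=]]]; rewrite in_itv /= => t1 ->; rewrite !PsiE.
  have [_ h] := FK x y s t Mx My s1 t1; apply: le_trans h.
  by case: (pair_rv_dist x y s t).
have inj z z' : X z -> X z' -> Psi z = Psi z' -> z = z'.
  move=> Xz Xz' zz'; apply/eqP; rewrite -subr_eq0 -normr_le0.
  by rewrite (le_trans (lower _ _ Xz Xz'))// zz' subrr normr0 mulr0.
have loc m k (Y : set 'rV[R]_m) (h : 'rV[R]_m -> 'rV[R]_k) :
    lipschitz_in Y h -> locally_lipschitz_in Y h.
  by move=> hL y Yy; exists setT; rewrite setIT; split=> //; exact: openT.
exists Psi; split.
- split.
  + by move=> z z' /set_mem Xz /set_mem Xz'; exact: inj.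
  + by apply/loc/lipschitz_in_norm; exists (K * 2); rewrite ?mulr_ge0.
  + pose g y := xget 0 [set z | X z /\ Psi z = y].
    have gK z : X z -> g (Psi z) = z.
      move=> Xz; rewrite /g; case: xgetP => [z' _ [Xz' /(inj _ _ Xz' Xz)]//|].
      by move=> /(_ z)[].
    exists g; split=> //; apply/loc/lipschitz_in_norm; exists K => //.
    by move=> _ _ [z Xz <-] [z' Xz' <-]; rewrite !gK//; exact: lower.
- by move=> x Mx; rewrite PsiE F0.
- move=> _ [_ [x [t [Mx /= t1 ->]]] <-]; rewrite PsiE; exact: FO.
- move=> _ [_ [x [t [Mx /= t1 ->]]] <-]; rewrite PsiE; exact: FC.
Qed.
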